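(* Let $H$ be a finite dimensional complex Hilbert space and let $\alpha:\mathcal{B}(H)\to\mathcal{B}(H)$ be a completely positive map which is nilpotent of order $p$. Then $p\le\dim(H)$.
   Context: $\mathcal{B}(H)$ is the algebra of all linear maps on $H$. A linear map $A$ is nilpotent of order $p$ if $A^p=0$ and $p$ is the smallest such number; $\alpha^p$ is the $p$-fold composition of $\alpha$ with itself. *)

(* Defs.v *)
From mathcomp Require Import all_boot all_order all_algebra.
From mathcomp Require Import sesquilinear.
From mathcomp Require Import complex.
From mathcomp Require Import reals.

Set Implicit Arguments.
Unset Strict Implicit.
Unset Printing Implicit Defensive.

Import Order.TTheory GRing.Theory Num.Theory.

Local Open Scope ring_scope.

(* {dot H for Num.conj} is linear in the first argument and conjugate-linear
   in the second. *)

Section CompletelyPositive.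

Variables (C : numClosedFieldType) (H : vectType C).
Variable dot : {dot H for Num.conj}.

(* The inner product of the k-fold orthogonal direct sum H (+) ... (+) H. *)
Definition dsum_dot (k : nat) (x y : {ffun 'I_k -> H}) : C :=
  \sum_(i < k) dot (x i) (y i).

(* The operator on the k-fold direct sum given by an element of M_k(B(H)). *)
Definition opmx_act (k : nat) (A : 'M['End(H)]_k) (x : {ffun 'I_k -> H}) :
    {ffun 'I_k -> H} :=
  [ffun i => \sum_(j < k) A i j (x j)].

(* In a numClosedFieldType, 0 <= z says that z is real and nonnegative, so over
   the complex numbers positive operators are automatically self-adjoint. *)
Definition positive_opmx (k : nat) (A : 'M['End(H)]_k) : Prop :=
  forall x : {ffun 'I_k -> H}, 0 <= dsum_dot (opmx_act A x) x.

(* M_k(B(H)) is B(H) (x) M_k, and map_mx alpha is alpha (x) id. *)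
Definition completely_positive (alpha : {linear 'End(H) -> 'End(H)}) : Prop :=
  forall (k : nat) (A : 'M['End(H)]_k),
    positive_opmx A -> positive_opmx (map_mx alpha A).

End CompletelyPositive.

(* The zeroth power is the identity, so the order is 0 exactly when V = 0;
   if V != 0 the order is at least 1. *)
Definition nilpotent_of_order (V : zmodType) (f : V -> V) (p : nat) : Prop :=
  (forall v, iter p f v = 0) /\
  (forall m : nat, (m < p)%N -> ~ (forall v, iter m f v = 0)).

(* Main.v *)
(* Put P_n = alpha^n(1) and K_n = ker P_n.  For positive operators A, B on a
   finite dimensional space, ker B <= ker A is equivalent to A <= c B for some
   scalar c, so a positive map preserves inclusions of kernels.  Hence K_n is
   increasing, and it is constant from the first n with K_n = K_(n+1) on.
   Moreover P_n = 0 forces alpha^n = 0, because every positive operator is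
   dominated by a multiple of 1 and the positive operators span B(H).  If alpha
   has order p, then 0 = K_0 < K_1 < ... < K_p = H is a strict chain of
   subspaces, so p <= dim H. *)
From HB Require Import structures.
Require Import Defs.
From mathcomp Require Import all_boot all_order all_algebra.
From mathcomp Require Import sesquilinear.
From mathcomp Require Import complex.
From mathcomp Require Import reals.
From mathcomp Require Import ring.
Local Open Scope ring_scope.
Import Order.TTheory GRing.Theory Num.Theory.

Section PositiveMaps.

Variables (C : numClosedFieldType) (H : vectType C).
Variable dot : {dot H for Num.conj}.
Implicit Types (x y z u v w : H) (A B : 'End(H)) (U V : {vspace H}).

Lemma dotDl x y z : dot (x + y) z = dot x z + dot y z.
Proof. exact: linearDl. Qed.

Lemma dotDr x y z : dot x (y + z) = dot x y + dot x z.
Proof. exact: linearDr. Qed.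

Lemma dotNl x y : dot (- x) y = - dot x y.
Proof. exact: linearNl. Qed.

Lemma dotNr x y : dot x (- y) = - dot x y.
Proof. exact: linearNr. Qed.

Lemma dotBl x y z : dot (x - y) z = dot x z - dot y z.
Proof. exact: linearBl. Qed.

Lemma dotZl (a : C) x y : dot (a *: x) y = a * dot x y.
Proof. exact: linearZl_LR. Qed.

Lemma dotZr (a : C) x y : dot x (a *: y) = a^* * dot x y.
Proof. exact: linearZr_LR. Qed.

Lemma dotC x y : dot x y = (dot y x)^*.
Proof. by rewrite hermC expr0 mul1r. Qed.

Lemma dot_ext x y : (forall z, dot x z = dot y z) -> x = y.
Proof.
move=> xy; apply/eqP; rewrite -subr_eq0 -(dnorm_eq0 dot).
by rewrite dotBl xy subrr.
Qed.

(** * Positive operators *)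

Definition positive_op A : Prop := forall x, 0 <= dot (A x) x.

Lemma positive_op_id : positive_op \1%VF.
Proof. by move=> x; rewrite id_lfunE dnorm_ge0. Qed.

Lemma positive_op_herm A x y : positive_op A -> dot (A y) x = (dot (A x) y)^*.
Proof.
move=> posA; have re z : (dot (A z) z)^* = dot (A z) z.
  by apply/CrealP/ger0_real/posA.
have h1 := re (x + y); have h2 := re (x + 'i *: y).
rewrite !(linearD, linearZ) /= !(dotDl, dotDr, dotZl, dotZr) in h1 h2.
rewrite !(rmorphD, rmorphM) /= !conjCK !re conjCi in h1 h2.
apply: (@mulfI _ (2%:R * 'i)); first by rewrite mulf_neq0 ?neq0Ci ?pnatr_eq0.
move: h1 h2 => /eqP; rewrite -subr_eq0 => /eqP h1 /eqP.
rewrite -subr_eq0 => /eqP h2.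
apply/eqP; rewrite -subr_eq0 -oppr_eq0; apply/eqP.
(* In 'i times the first relation plus the second, <Ax, y> and the conjugate of <Ay, x> cancel; what
   is left is 2'i times the desired difference. *)
have {h1 h2} := congr2 (fun a b => 'i * a + b) h1 h2.
by rewrite mulr0 addr0 => h; apply: etrans h; ring.
Qed.

(** If <Ax, x> = 0, the form of [A] at [w *: x + y] is 2 Re(w <Ax, y>) + <Ay, y>, unbounded below in
    [w] unless <Ax, y> = 0. *)
Lemma positive_op_eq0 A x : positive_op A -> dot (A x) x = 0 -> A x = 0.
Proof.
move=> posA Axx; apply/eqP; rewrite -(dnorm_eq0 dot); apply/eqP.
suff h y : dot (A x) y = 0 by exact: h.
apply/eqP/negPn/negP => z0.
have byy := posA y; set z := dot (A x) y in z0.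
(* Chosen so that <A (w x + y), w x + y> = -1. *)
pose w := - (dot (A y) y + 1) / (2%:R * z).
have wz : w * z = - (dot (A y) y + 1) / 2%:R.
  by rewrite /w; field; rewrite z0 ?pnatr_eq0.
have := posA (w *: x + y).
rewrite !(linearD, linearZ) /= !(dotDl, dotDr, dotZl, dotZr) Axx.
rewrite (positive_op_herm _ x y posA) -/z !mulr0 add0r -rmorphM wz /=.
have -> : (- (dot (A y) y + 1) / 2%:R)^* = - (dot (A y) y + 1) / 2%:R.
  apply/CrealP; rewrite rpred_div ?rpredN ?rpredD ?rpred1 ?realn //.
  exact: ger0_real.
have -> : - (dot (A y) y + 1) / 2%:R + (- (dot (A y) y + 1) / 2%:R + dot (A y) y)
  = -1 :> C by field.
by rewrite lerNr oppr0 ler10.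
Qed.

(** * Rank-one operators, orthogonal splitting and domination *)

Fact dyad_is_linear x y : linear (fun z => dot z y *: x).
Proof. by move=> a u v /=; rewrite dotDl dotZl scalerDl scalerA. Qed.

Definition dyad_fun x y z := dot z y *: x.
HB.instance Definition _ x y :=
  GRing.isLinear.Build C H H *:%R (dyad_fun x y) (dyad_is_linear x y).

Definition dyad x y : 'End(H) := linfun (dyad_fun x y).

Lemma dyadE x y z : dyad x y z = dot z y *: x.
Proof. by rewrite lfunE. Qed.

Lemma positive_dyad x : positive_op (dyad x x).
Proof.
by move=> z; rewrite dyadE dotZl (dotC x z) mul_conjC_ge0.
Qed.

(* When v <> 0, [lker (dyad v v \o A)] is the hyperplane <A x, v> = 0. *)
Lemma dim_cap_orth A v U : v \in U -> dot (A v) v != 0 ->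
  (\dim (U :&: lker (dyad v v \o A)) < \dim U)%N.
Proof.
move=> vU Avv.
have := dimv_leqif_sup (capvSl U (lker (dyad v v \o A))%VF) => /ltn_leqif ->.
apply/negP => /subvP /(_ v vU); rewrite memv_cap vU memv_ker comp_lfunE dyadE.
rewrite scaler_eq0 (negPf Avv) /= => /eqP v0.
by move: Avv; rewrite v0 linear0r eqxx.
Qed.

(** A Gram-Schmidt step for the form <A_, _>. It is used with a positive operator for domination and
    with the identity for orthogonal bases. *)
Lemma mem_cap_orth A v x U : v \in U -> dot (A v) v != 0 ->
  x \in U ->
  x - (dot (A x) v / dot (A v) v) *: v \in (U :&: lker (dyad v v \o A))%VS.
Proof.
move=> vU Avv xU; rewrite memv_cap rpredB ?rpredZ //=.
rewrite memv_ker comp_lfunE dyadE linearB linearZ /= dotBl dotZl.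
by rewrite divfK // subrr scale0r.
Qed.

Lemma cap_orthP A v x U : dot (A v) v != 0 ->
  x \in (U :&: lker (dyad v v \o A))%VS -> dot (A x) v = 0.
Proof.
move=> Avv; rewrite memv_cap memv_ker comp_lfunE dyadE scaler_eq0.
case/andP=> _ /orP[/eqP // | /eqP v0].
by rewrite v0 linear0r.
Qed.

(** Induction on dim U: split off a [v] in U outside ker B and pass to its B-orthogonal complement
    in U. If there is no such [v], both forms vanish on U. *)
Lemma positive_op_dominate_on A B U : positive_op A -> positive_op B ->
  (lker B <= lker A)%VS ->
  exists2 c : C, 0 <= c & {in U, forall x, dot (A x) x <= c * dot (B x) x}.
Proof.
move=> posA posB kBA.
have [n] := ubnP (\dim U); elim: n U => // n IHn U dimU.
have [UkB|/subvPn[v vU vkB]] := boolP (U <= lker B)%VS.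
  exists 0 => // x /(subvP (subv_trans UkB kBA)).
  by rewrite memv_ker => /eqP ->; rewrite linear0l mul0r.
have Bvv : dot (B v) v != 0.
  by apply: contra vkB => /eqP /(positive_op_eq0 _ _ posB) /eqP; rewrite memv_ker.
have [] := IHn (U :&: lker (dyad v v \o B))%VS.
  by rewrite (leq_trans (dim_cap_orth _ _ _ vU Bvv)).
move=> c c0 Hc; set d := dot (A v) v / dot (B v) v.
have d0 : 0 <= d by rewrite divr_ge0.
(* [c] serves the complement and [d] the line of [v]; the factor 2 pays for the cross terms of
   [A]. *)
exists (2%:R * (c + d)); first by rewrite mulr_ge0 ?addr_ge0.
move=> x xU; have := mem_cap_orth _ _ _ _ vU Bvv xU.
set t := dot (B x) v / dot (B v) v; set y := x - t *: v => yW.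
have -> : x = y + t *: v by rewrite subrK.
clearbody t y.
have Byv := cap_orthP _ _ _ _ Bvv yW.
have Bvy : dot (B v) y = 0 by rewrite (positive_op_herm _ y v posB) Byv conjC0.
have tt : 0 <= t * t^* by rewrite mul_conjC_ge0.
(* Parallelogram law: the second summand is nonnegative, so dropping it bounds the first without any
   control of cross terms. *)
have par : dot (A (y + t *: v)) (y + t *: v) + dot (A (y - t *: v)) (y - t *: v)
  = 2%:R * (dot (A y) y + t * t^* * dot (A v) v).
  rewrite -scaleNr !(linearD, linearZ) /= !(dotDl, dotDr, dotZl, dotZr).
  by rewrite rmorphN; ring.
apply: (@le_trans _ _ (2%:R * (dot (A y) y + t * t^* * dot (A v) v))).
  by rewrite -par lerDl.
rewrite -[leRHS]mulrA ler_pM2l ?ltr0n //.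
rewrite !(linearD, linearZ) /= !(dotDl, dotDr, dotZl, dotZr) Byv Bvy.
have -> : dot (A v) v = d * dot (B v) v by rewrite /d divfK.
(* The last parenthesis is a nonnegative surplus. *)
rewrite [leRHS](_ : _ = c * dot (B y) y + t * t^* * (d * dot (B v) v)
  + (d * dot (B y) y + c * (t * t^* * dot (B v) v))); last by ring.
rewrite -[leLHS]addr0; apply: lerD;
  last by apply: addr_ge0; do !apply: mulr_ge0 => //; exact: posB.
by apply: lerD => //; exact: Hc.
Qed.

Lemma positive_op_dominate A B : positive_op A -> positive_op B ->
  (lker B <= lker A)%VS ->
  exists c : C, positive_op (c *: B - A).
Proof.
move=> posA posB kBA.
have [c _ Hc] := positive_op_dominate_on _ _ fullv posA posB kBA.
exists c => x; rewrite add_lfunE opp_lfunE scale_lfunE dotBl dotZl subr_ge0.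
by rewrite Hc ?memvf.
Qed.

(** * Positive rank-one operators span *)

Lemma dual_frame U : exists s : seq (H * H),
  {in U, forall x, x = \sum_(p <- s) dot x p.1 *: p.2}.
Proof.
have [n] := ubnP (\dim U).
(* Keeping the first components in U makes those from the recursive call orthogonal to [v], so
   removing the [v]-part of x does not change their coefficients. *)
suff: (\dim U < n)%N -> exists2 s : seq (H * H),
  {in s, forall p, p.1 \in U} & {in U, forall x, x = \sum_(p <- s) dot x p.1 *: p.2}.
  by move=> h /h[s _ ?]; exists s.
elim: n U => // n IHn U dimU.
have [->|U0] := eqVneq U 0%VS.
  by exists [::] => // x; rewrite memv0 big_nil => /eqP.
have vU := memv_pick U; set v := vpick U in vU.
have Ivv : dot (\1%VF v) v != 0 by rewrite id_lfunE dnorm_eq0 vpick0.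
have [] := IHn (U :&: lker (dyad v v \o \1))%VS.
  by rewrite (leq_trans (dim_cap_orth _ _ _ vU Ivv)).
move=> s sW Hs; exists ((v, (dot v v)^-1 *: v) :: s).
  move=> p; rewrite inE => /orP[/eqP -> //| /sW].
  by rewrite memv_cap => /andP[].
move=> x xU; rewrite big_cons /= scalerA.
have := mem_cap_orth _ _ _ _ vU Ivv xU; rewrite !id_lfunE => xW.
rewrite {1}(_ : x = (dot x v / dot v v) *: v + (x - (dot x v / dot v v) *: v)).
  congr (_ + _); rewrite [LHS]Hs //; apply: eq_big_seq => -[p q] /sW /= pW.
  have := cap_orthP _ _ _ _ Ivv pW; rewrite id_lfunE => pv.
  rewrite dotBl dotZl (dotC v p) pv.
  by rewrite conjC0 !mulr0 subr0.
by rewrite addrC subrK.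
Qed.

Lemma sum_dyads A : exists s : seq (H * H), A = \sum_(p <- s) dyad p.1 p.2.
Proof.
have [s Hs] := dual_frame fullv.
exists [seq (A p.2, p.1) | p <- s]; apply/lfunP => x; rewrite big_map.
rewrite {1}[x]Hs ?memvf // linear_sum sum_lfunE; apply: eq_bigr => p _.
by rewrite linearZ dyadE.
Qed.

Lemma dyad_polar x y : dyad x y *+ 4 =
  dyad (x + y) (x + y) - dyad (x - y) (x - y)
  + 'i *: (dyad (x + 'i *: y) (x + 'i *: y) - dyad (x - 'i *: y) (x - 'i *: y)).
Proof.
apply/lfunP => z; apply: dot_ext => w; rewrite -scaler_nat.
rewrite !(add_lfunE, opp_lfunE, scale_lfunE, dyadE).
rewrite !(dotDl, dotDr, dotNl, dotNr, dotZl, dotZr) conjCi.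
have i2 : 'i ^+ 2 = -1 :> C by exact: sqrCi.
by ring: i2.
Qed.

(** Dyads span, and by polarization each is a combination of positive dyads [dyad u u]. *)
Lemma linear_eq0_positive (f : {linear 'End(H) -> 'End(H)}) :
  (forall A, positive_op A -> f A = 0) -> forall A, f A = 0.
Proof.
move=> f0 A; have [s ->] := sum_dyads A; rewrite linear_sum big1 // => -[x y] _ /=.
have f0xx u : f (dyad u u) = 0 by exact: f0 (positive_dyad u).
have := congr1 f (dyad_polar x y).
rewrite linearMn linearD linearZ !linearB !f0xx subrr /= scaler0 addr0 => /eqP.
by rewrite -scaler_nat scaler_eq0 pnatr_eq0 /= => /eqP.
Qed.

(** On ker B the form of [c *: B - A] is -<Ax, x>, which forces <Ax, x> = 0. *)
Lemma positive_op_le_ker A B (c : C) : positive_op A ->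
  positive_op (c *: B - A) -> (lker B <= lker A)%VS.
Proof.
move=> posA le; apply/subvP => x; rewrite !memv_ker => /eqP Bx.
apply/eqP/(positive_op_eq0 _ _ posA)/eqP; rewrite eq_le posA andbT.
have := le x; rewrite add_lfunE opp_lfunE scale_lfunE dotBl dotZl Bx linear0l.
by rewrite mulr0 sub0r oppr_ge0.
Qed.

Lemma lker_idlf : lker (\1%VF : 'End(H)) = 0%VS.
Proof.
apply/eqP; rewrite -subv0; apply/subvP => x.
by rewrite memv_ker id_lfunE memv0.
Qed.

(** * Kernels along the iterates of a positive map *)

Section Nilpotent.

Variable alpha : {linear 'End(H) -> 'End(H)}.
Hypothesis pos_alpha : forall A, positive_op A -> positive_op (alpha A).

Lemma iter_linear n : exists f : {linear 'End(H) -> 'End(H)}, iter n alpha =1 f.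
Proof.
elim: n => [|n [f Hf]]; first by exists idfun.
by exists (alpha \o f) => A /=; rewrite Hf.
Qed.

Let P n := iter n alpha \1%VF.

Lemma pos_iter n A : positive_op A -> positive_op (iter n alpha A).
Proof. by move=> posA; elim: n => //= n; exact: pos_alpha. Qed.

Lemma lker_iter n A B : positive_op A -> positive_op B ->
  (lker B <= lker A)%VS -> (lker (iter n alpha B) <= lker (iter n alpha A))%VS.
Proof.
move=> posA posB /(positive_op_dominate _ _ posA posB) [c le].
apply: (positive_op_le_ker _ _ c); first exact: pos_iter.
have := pos_iter n _ le; have [f Hf] := iter_linear n.
by rewrite !Hf linearB linearZ.
Qed.

Lemma lker_iter_id n : (lker (P n) <= lker (P n.+1))%VS.
Proof.
(* [iterSr] puts the extra [alpha] innermost, so the operators compared are [alpha \1] and [\1], and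
   the latter has zero kernel. *)
rewrite /P iterSr; apply: lker_iter; rewrite ?lker_idlf ?sub0v //.
  exact: pos_alpha positive_op_id.
exact: positive_op_id.
Qed.

(** One more [alpha] turns ker P_(m+n) <= ker P_n into ker P_(m+n+1) <= ker P_(n+1), and the
    hypothesis brings this back to ker P_n. *)
Lemma lker_iter_stable n : (lker (P n.+1) <= lker (P n))%VS ->
  forall m, (lker (P (m + n)) <= lker (P n))%VS.
Proof.
move=> le; elim=> // m IHm; apply: subv_trans le.
exact: (lker_iter 1 _ _ (pos_iter n _ positive_op_id)
  (pos_iter (m + n) _ positive_op_id) IHm).
Qed.

Lemma iter_eq0_id n : P n = 0 -> forall A, iter n alpha A = 0.
Proof.
move=> Pn0; have [f Hf] := iter_linear n => A; rewrite Hf.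
apply: linear_eq0_positive => {}A posA; rewrite -Hf.
have := lker_iter n _ _ posA positive_op_id; rewrite lker_idlf sub0v => /(_ isT).
rewrite -/(P n) Pn0 => /subvP h; apply/lfunP => x; apply/eqP.
by rewrite zero_lfunE -memv_ker h // memv_ker zero_lfunE.
Qed.

Lemma nilpotent_positive_order p : nilpotent_of_order alpha p ->
  (p <= \dim {:H})%N.
Proof.
case=> nil minp.
suff h n : (n <= p)%N -> (n <= \dim (lker (P n)))%N.
  by apply: leq_trans (h p _) (dimvS (subvf _)).
elim: n => // n IHn np; apply: leq_ltn_trans (IHn (ltnW np)) _.
have := dimv_leqif_sup (lker_iter_id n) => /ltn_leqif ->; apply/negP => le.
apply: (minp n np) => A; apply: iter_eq0_id; apply/lfunP => x.
apply/eqP; rewrite zero_lfunE -memv_ker.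
(* Taking m = p - n reaches P_p = 0, whose kernel is all of H; so P_n = 0, against the minimality of
   [p]. *)
apply: (subvP (lker_iter_stable _ le (p - n))).
by rewrite subnK ?(ltnW np) // memv_ker /P nil zero_lfunE.
Qed.

End Nilpotent.

Lemma completely_positive_positive (alpha : {linear 'End(H) -> 'End(H)}) :
  completely_positive dot alpha ->
  forall A, positive_op A -> positive_op (alpha A).
Proof.
move=> cp A posA x.
(* The case k = 1, with [A] as a 1 x 1 matrix and [x] as a one-term family. *)
have := cp 1%N (const_mx A); rewrite /positive_opmx /dsum_dot => h.
have := h _ [ffun=> x]; rewrite big_ord1 !ffunE big_ord1 !ffunE !mxE; apply.
by move=> y; rewrite big_ord1 !ffunE big_ord1 !mxE.
Qed.

End PositiveMaps.

Theorem corollary2p5 (R : realType) (H : vectType R[i])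
    (dot : {dot H for Num.conj})
    (alpha : {linear 'End(H) -> 'End(H)}) (p : nat) :
  completely_positive dot alpha ->
  nilpotent_of_order alpha p ->
  (p <= \dim {:H})%N.
Proof.
move=> cp; apply: (nilpotent_positive_order _ _ dot).
exact: completely_positive_positive cp.
Qed.
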